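(* Let $n\ge 2$. Then $B(Q_n)=n$. Furthermore, a zero blocking set $W$ of $Q_n$ is minimum (i.e. $|W|=n$) if and only if either $W=N(x)$ for some vertex $x$ of $Q_n$, or $n=4$ and $W=N(y)\,\Delta\, N(z)$ for two vertices $y,z$ of $Q_4$ with $|y\,\Delta\, z|=2$.
   Context: The hypercube $Q_n$ is the graph whose vertices are the subsets of $[n]=\{1,\ldots,n\}$, with $x,y$ adjacent iff $|x\,\Delta\, y|=1$, where $A\,\Delta\, B=(A\cup B)\setminus(A\cap B)$. $N(x)$ is the set of neighbors of $x$. In a graph each vertex is black or white; in the zero forcing process, if a black vertex has exactly one white neighbor $w$, then $w$ becomes black, iterated. A set $S$ of initially black vertices is a failed zero forcing set if the process does not make all vertices black, and then its complement (the initial set of white vertices) is a zero blocking set. $B(G)$ is the minimum size of a zero blocking set of $G$. *)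

(* Defs.v *)
From mathcomp Require Import all_boot.

Set Implicit Arguments.
Unset Strict Implicit.
Unset Printing Implicit Defensive.

Definition symdiff (T : finType) (A B : {set T}) : {set T} :=
  (A :|: B) :\: (A :&: B).

(* A finite simple graph is given by its adjacency relation on a finType. *)
Section ZeroForcing.

Variables (T : finType) (adj : rel T).
Implicit Types (S W : {set T}) (v w : T).

Definition nbhd v : {set T} := [set w | adj v w].

(* The black set S forces w through the black vertex v: w is the unique white
   neighbour of v. *)
Definition forces S v w : bool := (v \in S) && (nbhd v :\: S == [set w]).

Definition zf_step S : {set T} := S :|: [set w | [exists v, forces S v w]].

(* Every step that is not stationary blackens a new vertex, so the process is
   stationary after #|T| steps (zf_final_stable). *)
Definition zf_final S : {set T} := iter #|T| zf_step S.

Definition failed_zero_forcing S : bool := zf_final S != [set: T].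

Definition zero_blocking W : bool := failed_zero_forcing (~: W).

(* If T is nonempty then [set: T] is zero blocking, so the arg min is taken over
   a nonempty family; for empty T there is no zero blocking set and the value
   is 0. *)
Definition zero_blocking_number : nat :=
  #|[arg min_(W < [set: T] | zero_blocking W) #|W|]|.

Lemma zf_step_sub S : S \subset zf_step S.
Proof. exact: subsetUl. Qed.

Lemma zf_final_stable S : zf_step (zf_final S) = zf_final S.
Proof.
have H k : zf_step (iter k zf_step S) = iter k zf_step S \/
           k <= #|iter k zf_step S|.
  elim: k => [|k [IH|IH]]; [by right | by left; rewrite iterS IH |].
  case: (eqVneq (zf_step (iter k zf_step S)) (iter k zf_step S)) => [E|ne].
    by left; rewrite iterS E.
  right; apply: leq_ltn_trans IH _; apply: proper_card.
  by rewrite properEneq eq_sym ne zf_step_sub.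
case: (H #|T|) => // leT.
suff -> : zf_final S = [set: T] by rewrite /zf_step setTU.
by apply/eqP; rewrite eqEcard subsetT cardsT.
Qed.

Lemma zero_blocking_setT (x : T) : zero_blocking [set: T].
Proof.
rewrite /zero_blocking /failed_zero_forcing /zf_final setCT.
have step0 : zf_step set0 = set0.
  apply/setP=> w; rewrite !inE; apply/negbTE/existsPn=> v.
  by rewrite /forces inE.
have -> : iter #|T| zf_step set0 = set0 by elim: #|T| => //= k ->.
by apply/eqP=> /setP/(_ x); rewrite !inE.
Qed.

Lemma zero_blocking_number_min (x : T) :
  (exists2 W, zero_blocking W & #|W| = zero_blocking_number) /\
  (forall W, zero_blocking W -> zero_blocking_number <= #|W|).
Proof.
rewrite /zero_blocking_number.
case: arg_minnP => [|W zbW minW]; first exact: zero_blocking_setT x.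
by split; first exists W.
Qed.

End ZeroForcing.

(* 'I_n = {0, ..., n-1} plays the role of [n]. *)
Definition hypercube (n : nat) : rel {set 'I_n} :=
  fun x y => #|symdiff x y| == 1.
Arguments hypercube n : clear implicits.

Lemma hypercube_sym n : symmetric (hypercube n).
Proof. by move=> x y; rewrite /hypercube /symdiff setUC setIC. Qed.

Lemma hypercube_irr n : irreflexive (hypercube n).
Proof. by move=> x; rewrite /hypercube /symdiff setUid setIid setDv cards0. Qed.

(* Main.v *)
(** A minimum zero blocking set W is a fort: W is nonempty and no vertex outside
    W has exactly one neighbour in W.  Call a vertex outside W with exactly one
    neighbour in W a defect.  Cutting the cube in a direction i, every defect of
    one half of W must be mirrored in the other half, so induction on the
    dimension gives |W| + #defects >= n, with equality only for forts; in
    particular a fort has at least n vertices.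

    Let W be a fort with n vertices.  If some half of W is tight in its
    subcube, the other half is a single vertex w and W is the neighbourhood of
    the mirror image of w.  Otherwise each half is exactly the mirrored defect
    set of the other: for w in W and every direction i the vertex w + i is
    outside W and has exactly two neighbours in W.  Then each vertex of W has n/2
    vertices of W at distance 2, and two vertices at distance 2 have no common
    one, so the two lists exhaust W; this forces n = 2 or n = 4. *)
Require Import Defs.
From mathcomp Require Import all_boot zify.

Set Implicit Arguments.
Unset Strict Implicit.
Unset Printing Implicit Defensive.

(** * Counting preliminaries *)

Lemma in_symdiff (T : finType) (A B : {set T}) x :
  (x \in symdiff A B) = (x \in A) (+) (x \in B).
Proof. by rewrite !inE; case: (x \in A); case: (x \in B). Qed.

Lemma card_symdiff (T : finType) (A B : {set T}) :
  #|symdiff A B| + 2 * #|A :&: B| = #|A| + #|B|.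
Proof.
have sI : A :&: B \subset A :|: B by rewrite subIset // subsetUl.
have := cardsU A B; have := subset_leq_card sI.
have := subset_leq_card (subsetIl A B).
rewrite /symdiff cardsD (setIidPr sI); lia.
Qed.

(** The fibre of [f] through [x] lies in the pair [{x, g x}]. *)
Lemma card_le_double_imset (aT rT : finType) (f : aT -> rT) (g : aT -> aT) :
  (forall x y, f x = f y -> y = x \/ y = g x) ->
  #|aT| <= 2 * #|f @: [set: aT]|.
Proof.
move=> fib; rewrite -cardsT -sum1_card (partition_big_imset f) /= mulnC -sum_nat_const.
apply: leq_sum => _ /imsetP [x _ ->]; rewrite sum1_card.
apply: leq_trans (_ : #|[set x; g x]| <= 2); last by rewrite cards2; case: eqP.
apply/subset_leq_card/subsetP => y /andP [_ /eqP fyx].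
by have [->|->] := fib x y (esym fyx); rewrite !inE eqxx ?orbT.
Qed.

(** * Coordinate flips and neighbourhoods *)

Section Hypercube.

Variable n : nat.
Implicit Types (x y v w : {set 'I_n}) (i j : 'I_n) (D : {set 'I_n}).
Implicit Types U W : {set {set 'I_n}}.

(* Locked to keep inE from unfolding membership in a flip. *)
Definition flip := locked (fun i x => symdiff x [set i]).

Lemma in_flip i x k : (k \in flip i x) = (k \in x) (+) (k == i).
Proof. by rewrite /flip -lock in_symdiff in_set1. Qed.

Lemma flipK i : involutive (flip i).
Proof. by move=> x; apply/setP => k; rewrite !in_flip addbK. Qed.

Lemma flip_inj i : injective (flip i).
Proof. exact: can_inj (flipK i). Qed.

Lemma flipC i j x : flip i (flip j x) = flip j (flip i x).
Proof. by apply/setP => k; rewrite !in_flip addbAC. Qed.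

Lemma flip_dir_inj x : injective (flip^~ x).
Proof.
move=> i j /setP /(_ i); rewrite !in_flip eqxx.
by case: eqP => //; case: (_ \in _).
Qed.

Lemma nbhdE x : nbhd (hypercube n) x = [set flip i x | i : 'I_n].
Proof.
apply/setP => y; rewrite inE /hypercube; apply/cards1P/imsetP => [[i Ei]|[i _ ->]].
  exists i => //; apply/setP => k.
  by rewrite in_flip -in_set1 -Ei in_symdiff addbA addbb.
by exists i; apply/setP => k; rewrite in_symdiff in_flip addbA addbb in_set1.
Qed.

Lemma card_nbhd x : #|nbhd (hypercube n) x| = n.
Proof. by rewrite nbhdE card_imset ?card_ord //; exact: flip_dir_inj. Qed.

(** * Defects, forts and the forcing process *)

Definition dirs D W v := [set i in D | flip i v \in W].

(** Passing to a subcube removes directions from [D] and leaves the vertex type unchanged, so the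
    induction on dimension is an induction on [#|D|]. *)
Definition defect D W := [set v | (v \notin W) && (#|dirs D W v| == 1)].

Lemma card_nbhdI W v : #|nbhd (hypercube n) v :&: W| = #|dirs setT W v|.
Proof.
rewrite nbhdE -(card_imset _ (@flip_dir_inj v)); apply: eq_card => y.
rewrite inE; apply/andP/imsetP => [[/imsetP [i _ ->] yW]|[i]].
  by exists i; rewrite ?inE.
by rewrite !inE /= => yW ->; split=> //; apply/imsetP; exists i.
Qed.

(** The white neighbours of [v] are those in [W], so the vertices able to force are exactly the
    defects. *)
Lemma zf_step_setC_id W :
  (zf_step (hypercube n) (~: W) == ~: W) = (defect setT W == set0).
Proof.
have DE v : nbhd (hypercube n) v :\: ~: W = nbhd (hypercube n) v :&: W.
  by rewrite setDE setCK.
apply/eqP/eqP => [st|d0].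
  apply/setP => v; rewrite in_set0; apply/negbTE/negP; rewrite inE.
  rewrite -card_nbhdI => /andP [vW /cards1P [w Ew]].
  have: w \in ~: W.
    rewrite -st in_setU; apply/orP; right; rewrite inE; apply/existsP; exists v.
    by rewrite /forces DE Ew in_setC vW eqxx.
  have: w \in nbhd (hypercube n) v :&: W by rewrite Ew set11.
  by rewrite in_setI in_setC => /andP [_ ->].
apply/eqP; rewrite eq_sym eqEsubset zf_step_sub; apply/subsetP => w.
rewrite in_setU => /orP [//|]; rewrite inE => /existsP [v].
rewrite /forces DE in_setC => /andP [vW /eqP Ew].
have : v \in defect setT W by rewrite inE vW -card_nbhdI Ew cards1.
by rewrite d0 inE.
Qed.

(** The fort is the set of vertices still white when the process stops. *)
Lemma zero_blocking_sub_fort W : zero_blocking (hypercube n) W ->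
  exists U : {set {set 'I_n}}, [/\ U \subset W, U != set0 & defect setT U = set0].
Proof.
move=> zb; exists (~: zf_final (hypercube n) (~: W)); split.
- rewrite -setCS setCK /zf_final; elim: #|_| => //= k IH.
  exact: subset_trans IH (zf_step_sub _ _).
- by apply: contraNneq zb => /(congr1 (@setC _)); rewrite setCK setC0 => ->.
- by apply/eqP; rewrite -zf_step_setC_id setCK zf_final_stable.
Qed.

Lemma fort_zero_blocking W :
  W != set0 -> defect setT W = set0 -> zero_blocking (hypercube n) W.
Proof.
move=> W0 /eqP; rewrite -zf_step_setC_id => /eqP st.
rewrite /zero_blocking /failed_zero_forcing /zf_final.
have -> : iter #|{set 'I_n}| (zf_step (hypercube n)) (~: W) = ~: W.
  by elim: #|_| => //= k ->.
by apply: contra W0; rewrite -setC0 (inj_eq (@setC_inj _)).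
Qed.

(** A vertex [flip i (flip j x)] is adjacent to both [flip i x] and [flip j x]. A defect would thus
    need [i = j], making it [x], which has [n >= 2] neighbours. *)
Lemma nbhd_fort x : 2 <= n -> defect setT (nbhd (hypercube n) x) = set0.
Proof.
move=> hn; apply/setP => v; rewrite inE in_set0; apply/negP => /andP [vW /cards1P [i Ei]].
have memN j k : j \in dirs setT (nbhd (hypercube n) x) (flip j (flip k x)).
  by rewrite nbhdE !inE flipK /=; apply/imsetP; exists k.
have : i \in dirs setT (nbhd (hypercube n) x) v by rewrite Ei set11.
rewrite nbhdE !inE /= => /imsetP [j _ Ej].
have vE : v = flip i (flip j x) by rewrite -Ej flipK.
have : j \in [set i] by rewrite -Ei vE flipC memN.
rewrite inE => /eqP ji; rewrite {}ji flipK in vE; move: Ei; rewrite vE => Ei.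
suff : #|'I_n| <= #|[set i]| by rewrite cards1 card_ord leqNgt hn.
rewrite -cardsT -Ei; apply/subset_leq_card/subsetP => k _.
by rewrite -[in X in dirs _ _ X](flipK k x) memN.
Qed.

(** * Cutting in a direction and the counting induction *)

Definition half i (b : bool) W := [set w in W | (i \in w) == b].

Lemma card_half i b W : #|W| = #|half i b W| + #|half i (~~ b) W|.
Proof.
rewrite -[LHS](cardsID [set w : {set 'I_n} | (i \in w) == b] W); congr (_ + _).
  by apply: eq_card => w; rewrite !inE.
by apply: eq_card => w; rewrite !inE andbC; case: (i \in w); case: b.
Qed.

(** Restoring direction [i] adds only the neighbour [flip i v]. If it is in [W], then [v] mirrors a
    vertex of the other half; otherwise [v] remains a defect of [W]. *)
Lemma defect_half D W i b : i \in D ->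
  defect (D :\ i) (half i b W)
    \subset [set flip i w | w in half i (~~ b) W] :|: half i b (defect D W).
Proof.
move=> iD; apply/subsetP => v; rewrite inE => /andP [vW d1].
(* Directions other than [i] do not change sides, so a neighbour in the half puts [v] on side
   [b]. *)
have vb : (i \in v) == b.
  case/cards1P: (d1) => j Ej.
  have : j \in dirs (D :\ i) (half i b W) v by rewrite Ej set11.
  rewrite !inE => /andP [/andP [ji _] /andP [_]].
  by rewrite in_flip [i == j]eq_sym (negbTE ji) addbF.
have {}vW : v \notin W by move: vW; rewrite inE vb andbT.
rewrite in_setU; have [fW|fW] := boolP (flip i v \in W).
  apply/orP; left; apply/imsetP; exists (flip i v); last by rewrite flipK.
  by rewrite inE fW in_flip eqxx /= (eqP vb); case: (b).
apply/orP; right; rewrite inE vb andbT inE vW -(eqP d1); apply/eqP/eq_card => j.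
rewrite !inE; case: (eqVneq j i) => [->|ji]; first by rewrite (negbTE fW) andbF.
by rewrite in_flip [i == j]eq_sym (negbTE ji) addbF vb andbT.
Qed.

Lemma card_defect_half D W i b : i \in D ->
  #|defect (D :\ i) (half i b W)| <= #|half i (~~ b) W| + #|half i b (defect D W)|.
Proof.
move=> /(defect_half W b) /subset_leq_card /leq_trans; apply.
by apply: leq_trans (leq_card_setU _ _) _; rewrite leq_add2r leq_imset_card.
Qed.

(** Each mirror image [flip i w] sees only [w] in [W], hence is a defect. *)
Lemma half_empty_defect D W i b : i \in D -> half i (~~ b) W = set0 ->
  #|W| <= #|half i (~~ b) (defect D W)|.
Proof.
move=> iD e0.
have Wb w : w \in W -> (i \in w) = b.
  move=> wW; apply/eqP; apply: contraT => wb.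
  have : w \in half i (~~ b) W by rewrite inE wW; move: wb; case: (i \in w); case: (b).
  by rewrite e0 inE.
rewrite -(card_imset W (@flip_inj i)); apply/subset_leq_card/subsetP => _ /imsetP [w wW ->].
have ifw : (i \in flip i w) = ~~ b by rewrite in_flip eqxx Wb // addbT.
rewrite inE ifw eqxx andbT inE; apply/andP; split.
  by apply/negP => /Wb; rewrite ifw; case: (b).
apply/cards1P; exists i; apply/setP => j; rewrite !inE.
case: (eqVneq j i) => [->|ji]; first by rewrite iD flipK.
apply/negP => /andP [_ /Wb]; rewrite in_flip ifw [i == j]eq_sym (negbTE ji).
by case: (b).
Qed.

Lemma defect_set1 D w j : j \in D -> flip j w \in defect D [set w].
Proof.
move=> jD; rewrite !inE; apply/andP; split.
  by apply/eqP => /setP /(_ j); rewrite in_flip eqxx; case: (_ \in _).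
apply/cards1P; exists j; apply/setP => k; rewrite !inE.
case: (eqVneq k j) => [->|kj]; first by rewrite flipK eqxx andbT.
apply/negbTE; rewrite negb_and; apply/orP; right; apply: contraNneq kj => E.
by apply/eqP/(@flip_dir_inj (flip j w)); rewrite /= flipK.
Qed.

(* Counting the defects together with W is what makes the induction on D work:
   a defect of one half of W is cancelled only by its mirror image in the
   other half. *)
Lemma card_add_defect_tight D W :
  W != set0 -> #|W| + #|defect D W| <= #|D| ->
  defect D W = set0 /\ #|W| = #|D|.
Proof.
move: {2}#|D| (erefl #|D|) => d; elim: d D W => [|d IH] D W dD W0.
  by rewrite dD leqn0 addn_eq0 cards_eq0 (negbTE W0).
rewrite dD => le; have [i iD] : exists i, i \in D by apply/card_gt0P; rewrite dD.
have dD' : #|D :\ i| = d by move: dD; rewrite (cardsD1 i) iD => -[].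
(* By induction the half is defect-free with [d] vertices. If the other half is empty, its [d]
   mirrored defects give [2 * d <= d.+1], so [W] is a single vertex, which has a defect in a
   direction other than [i]. Otherwise the bound leaves one more vertex and no defect. *)
have half_tight b : half i b W != set0 ->
    (#|half i b W| + #|defect (D :\ i) (half i b W)| <= d) ->
    defect D W = set0 /\ #|W| = d.+1.
  move=> Wb0; rewrite -dD' => /(IH _ _ dD' Wb0); rewrite dD' => -[d0 cWb].
  have := card_half i b W; have [e0|ne0] := eqVneq (half i (~~ b) W) set0.
    have := half_empty_defect iD e0; have := card_half i b (defect D W).
    rewrite e0 cards0 addn0 cWb => cd cW cE.
    have cW1 : #|half i b W| == 1.
      have : 0 < #|half i b W| by rewrite card_gt0.
      lia.
    have /card_gt0P [j jD] : 0 < #|D :\ i| by rewrite dD' -cWb (eqP cW1).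
    case/cards1P: cW1 => w Ew; have := defect_set1 w jD.
    by rewrite -Ew d0 inE.
  move: ne0; rewrite -card_gt0 cWb => ne0 cE.
  suff : #|defect D W| = 0 by move/cards0_eq => ->; split=> //; lia.
  lia.
have half_neq0 b : half i b W = set0 -> half i (~~ b) W != set0.
  by move=> e0; rewrite -card_gt0; move: W0; rewrite -card_gt0 (card_half i b) e0 cards0.
(* When half [b] exceeds [d], [W] and the defects on side [b] already use up [d.+1], leaving none on
   the other side. Both values of [b] together exclude all defects. *)
have half_le b : defect D W = set0 /\ #|W| = d.+1 \/
    half i (~~ b) (defect D W) = set0 /\ d < #|W| + #|defect D W|.
  have [e0|ne0] := eqVneq (half i b W) set0.
    left; apply: (half_tight (~~ b)); first exact: half_neq0.
    have := half_empty_defect (b := ~~ b) iD; rewrite negbK => /(_ _ e0).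
    have := card_defect_half W (~~ b) iD; rewrite negbK e0 cards0.
    have := card_half i b (defect D W); have := card_half i b W.
    rewrite e0 cards0; move: W0; rewrite -card_gt0 => W0 c1 c2 c3 c4.
    lia.
  have [le'|gt'] := leqP (#|half i b W| + #|defect (D :\ i) (half i b W)|) d.
    by left; apply: (half_tight b).
  have := card_defect_half W b iD; have := card_half i b W.
  have := card_half i b (defect D W) => c1 c2 c3; right.
  suff : #|half i (~~ b) (defect D W)| = 0 by move/cards0_eq => ->; split=> //; lia.
  lia.
have [//|[e1 cW]] := half_le true; have [//|[e2 _]] := half_le false.
have d0 : #|defect D W| = 0 by rewrite (card_half i true) e1 e2 cards0.
split; [exact: cards0_eq | by move: le cW; rewrite d0 addn0 => le cW; lia].
Qed.

(** * Dichotomy for minimum forts *)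

Lemma half_neq0_fort W i b :
  W != set0 -> defect setT W = set0 -> half i b W != set0.
Proof.
rewrite -card_gt0 => W0 d0; apply/eqP => e0.
have := half_empty_defect (D := setT) (W := W) (b := ~~ b) (in_setT i).
rewrite negbK => /(_ e0); rewrite d0 leqNgt => /negP; apply.
by apply: leq_ltn_trans W0; rewrite leqn0 cards_eq0; apply/eqP/setP => v; rewrite !inE.
Qed.

(** For [j != i], the vertex [flip j w] has in [W] the neighbour [w] and at most one other, across
    direction [i]. Having no defects puts that one in [W], and cardinality turns the inclusion into
    equality. *)
Lemma half_set1_nbhd W i b w :
  defect setT W = set0 -> #|W| = n -> half i b W = [set w] ->
  W = nbhd (hypercube n) (flip i w).
Proof.
move=> d0 cW Ew; apply/eqP; rewrite eq_sym eqEcard card_nbhd cW leqnn andbT.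
have : w \in half i b W by rewrite Ew set11.
rewrite inE => /andP [wW wb].
have halfW v : v \in W -> (i \in v) == b -> v = w.
  by move=> vW vb; apply/set1P; rewrite -Ew inE vW vb.
rewrite nbhdE; apply/subsetP => _ /imsetP [j _ ->].
have [->|ji] := eqVneq j i; first by rewrite flipK.
have side : (i \in flip j w) == b.
  by rewrite in_flip [i == j]eq_sym (negbTE ji) addbF.
apply: contraT => fW; suff : flip j w \in defect setT W by rewrite d0 inE.
rewrite inE; apply/andP; split.
  apply/negP => /halfW /(_ side) /setP /(_ j); rewrite in_flip eqxx.
  by case: (_ \in _).
apply/cards1P; exists j; apply/setP => k; rewrite !inE /=.
have [->|kj] := eqVneq k j; first by rewrite flipK.
have [->|ki] := eqVneq k i; first by rewrite flipC (negbTE fW).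
apply/negP => /halfW E; case/eqP: kj; apply: (@flip_dir_inj (flip j w)).
by rewrite /= flipK E // in_flip [i == k]eq_sym (negbTE ki) addbF.
Qed.

(** If half [b] with its defects has at most [n.-1] elements, it is tight and the other half is one
    vertex. Otherwise there are at least as many defects as vertices in the other half, so the
    inclusion of [defect_half] is an equality. *)
Lemma min_fort_half W i b : W != set0 -> defect setT W = set0 -> #|W| = n ->
  (exists x, W = nbhd (hypercube n) x) \/
  {in half i (~~ b) W, forall w, flip i w \in defect (setT :\ i) (half i b W)}.
Proof.
move=> W0 d0 cW; have Wb0 := half_neq0_fort i b W0 d0.
have cD : #|[set: 'I_n] :\ i| = n.-1 by rewrite cardsDS ?sub1set ?inE // cardsT card_ord cards1 subn1.
have n0 : 0 < n by apply: leq_ltn_trans (ltn_ord i).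
have := card_half i b W; rewrite cW => cE.
have [le|gt] := leqP (#|half i b W| + #|defect (setT :\ i) (half i b W)|) n.-1.
  left; move: le; rewrite -cD => /(card_add_defect_tight Wb0) [_]; rewrite cD => cWb.
  have /cards1P [w Ew] : #|half i (~~ b) W| == 1 by lia.
  by exists (flip i w); apply: half_set1_nbhd Ew.
right=> w wW; have := defect_half W b (in_setT i); rewrite d0.
have -> : half i b set0 = set0 by apply/setP => v; rewrite !inE.
rewrite setU0 => sub.
suff -> : defect (setT :\ i) (half i b W) = [set flip i w | w in half i (~~ b) W].
  exact: imset_f.
apply/eqP; rewrite eqEcard sub card_imset; last exact: flip_inj.
by rewrite -(leq_add2l #|half i b W|) -cE -[X in X <= _](prednK n0).
Qed.

(** Direction [i] leads back to [w], so [flip i w] has exactly two neighbours in [W]. *)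
Definition paired W := forall w i, w \in W ->
  flip i w \notin W /\ #|dirs (setT :\ i) W (flip i w)| = 1.

Lemma min_fort_nbhd_or_paired W : W != set0 -> defect setT W = set0 -> #|W| = n ->
  (exists x, W = nbhd (hypercube n) x) \/ paired W.
Proof.
move=> W0 d0 cW.
have [/existsP [x /eqP Ex]|nN] := boolP [exists x, W == nbhd (hypercube n) x].
  by left; exists x.
right=> w i wW.
have [[x Ex]|] := min_fort_half i (~~ (i \in w)) W0 d0 cW.
  by case/existsP: nN; exists x; apply/eqP.
rewrite negbK => /(_ w); rewrite inE wW eqxx => /(_ isT).
have side : (i \in flip i w) = ~~ (i \in w) by rewrite in_flip eqxx addbT.
rewrite inE => /andP [fW /eqP <-]; split.
  by move: fW; rewrite inE side eqxx andbT.
apply: eq_card => j; rewrite !inE; have [//|ji] /= := eqVneq j i.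
by rewrite in_flip side [i == j]eq_sym (negbTE ji) addbF eqxx andbT.
Qed.

(** * Vertices at distance two in a paired set *)

Section Paired.

Variable W : {set {set 'I_n}}.
Hypothesis pairedW : paired W.

Lemma partner_exists w i : w \in W ->
  exists2 j, j != i & flip j (flip i w) \in W.
Proof.
move=> /(pairedW i) [_ /eqP /cards1P [j Ej]].
have : j \in dirs (setT :\ i) W (flip i w) by rewrite Ej set11.
by rewrite !inE andbT => /andP [ji jW]; exists j.
Qed.

Lemma partner_unique w i j k : w \in W -> j != i -> k != i ->
  flip j (flip i w) \in W -> flip k (flip i w) \in W -> j = k.
Proof.
move=> /(pairedW i) [_ /eqP /cards1P [l El]] ji ki jW kW.
have jl : j \in [set l] by rewrite -El !inE ji jW.
have kl : k \in [set l] by rewrite -El !inE ki kW.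
by rewrite (set1P jl) (set1P kl).
Qed.

Definition dist2 w :=
  [set u in W | [exists i, exists j, (j != i) && (u == flip j (flip i w))]].

Lemma dist2P w u :
  reflect (u \in W /\ exists i j, j != i /\ u = flip j (flip i w)) (u \in dist2 w).
Proof.
rewrite inE; apply: (iffP andP) => -[uW].
  by case/existsP => i /existsP [j /andP [ji /eqP E]]; split=> //; exists i, j.
case=> i [j [ji E]]; split=> //; apply/existsP; exists i; apply/existsP; exists j.
by rewrite ji E eqxx.
Qed.

(** Each direction and its partner give a vertex of [dist2 w], and that vertex determines the
    pair. *)
Lemma card_dist2 w : w \in W -> n <= 2 * #|dist2 w|.
Proof.
move=> wW.
(* The default [i] never arises, by [partner_exists]. *)
pose s i := odflt i [pick j | (j != i) && (flip j (flip i w) \in W)].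
have sP i : s i != i /\ flip (s i) (flip i w) \in W.
  rewrite /s; case: pickP => [j /andP [] //|]; have [j ji jW] := partner_exists i wW.
  by move/(_ j); rewrite ji jW.
rewrite -{1}(card_ord n).
apply: leq_trans (card_le_double_imset (f := fun i => flip (s i) (flip i w)) (g := s) _) _.
  move=> i j /setP /(_ j); rewrite !in_flip eqxx.
  have [sj _] := sP j; rewrite [j == s j]eq_sym (negbTE sj).
  have [->|ji] := eqVneq j i; first by left.
  by have [->|jsi] := eqVneq j (s i); [right | case: (_ \in _)].
rewrite leq_mul2l; apply/orP; right; apply/subset_leq_card/subsetP => _ /imsetP [i _ ->].
by have [si sW] := sP i; apply/dist2P; split=> //; exists i, (s i).
Qed.

(** The sums are membership in the symmetric difference of [{p}] and [{q}]: vertices at distance 2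
    do not differ in three directions. *)
Lemma no_three_in_two (a b c p q : 'I_n) : a != b -> a != c -> b != c ->
  ~ [/\ (a == p) (+) (a == q), (b == p) (+) (b == q) & (c == p) (+) (c == q)].
Proof.
move=> ab ac bc [].
have [Ap|_] := eqVneq a p; have [Bp|_] := eqVneq b p; have [Cp|_] := eqVneq c p;
have [Aq|_] := eqVneq a q; have [Bq|_] := eqVneq b q; have [Cq|_] := eqVneq c q => //;
by move: ab ac bc; subst; rewrite ?eqxx.
Qed.

(** Partners being unique, two pairs at [w] that share a direction coincide. *)
Lemma pairs_disjoint w i j p q : w \in W -> j != i -> q != p ->
  flip j (flip i w) \in W -> flip q (flip p w) \in W ->
  flip j (flip i w) != flip q (flip p w) ->
  [/\ i != p, i != q, j != p & j != q].
Proof.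
move=> wW ji qp jW qW ne; split; apply: contraNneq ne => E; subst; apply/eqP.
- by rewrite (partner_unique wW ji qp jW qW).
- rewrite flipC in qW; rewrite eq_sym in qp.
  by rewrite (partner_unique wW ji qp jW qW) flipC.
- rewrite flipC in jW; rewrite eq_sym in ji.
  by rewrite -(partner_unique wW ji qp jW qW) flipC.
- rewrite flipC in jW; rewrite flipC in qW; rewrite eq_sym in ji.
  rewrite eq_sym in qp.
  by rewrite (partner_unique wW ji qp jW qW).
Qed.

(** A common [u] distinct from [w'] arises from [w] by a pair disjoint from that of [w'], so [u] and
    [w'] differ in four directions, not two. *)
Lemma dist2_disjoint w w' : w \in W -> w' \in dist2 w -> [disjoint dist2 w & dist2 w'].
Proof.
move=> wW /dist2P [w'W [p [q [qp Ew']]]]; apply/pred0P => u /=.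
apply/negP => /andP [/dist2P [uW [i [j [ji Eu]]]] /dist2P [_ [k [l [lk Eu']]]]].
have E (x : 'I_n) : (x == k) (+) (x == l) = (x == i) (+) (x == j) (+) (x == p) (+) (x == q).
  move/setP: (esym Eu) => /(_ x); rewrite Eu' Ew' !in_flip.
  case: (x \in w); case: (x == i); case: (x == j); case: (x == k); case: (x == l);
  by case: (x == p); case: (x == q).
have [uw'|ne] := eqVneq u w'.
  have := E l; have -> : forall x : 'I_n, (x == i) (+) (x == j) (+) (x == p) (+) (x == q) = false.
    move=> x; move/setP: uw' => /(_ x); rewrite Eu Ew' !in_flip.
    by case: (x \in w); case: (x == i); case: (x == j); case: (x == p); case: (x == q).
  by rewrite eqxx (negbTE lk).
rewrite Eu Ew' in ne uW w'W.
have [ip iq jp jq] := pairs_disjoint wW ji qp uW w'W ne.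
move: (qp) (ip) (iq); rewrite ![_ == p]eq_sym [i == q]eq_sym => pq pi qi.
apply: (no_three_in_two (p := k) (q := l) pq pi qi); split; rewrite E eqxx.
- by rewrite (negbTE pi) [p == j]eq_sym (negbTE jp) (negbTE pq).
- by rewrite (negbTE qi) [q == j]eq_sym (negbTE jq) (negbTE qp).
- by rewrite [i == j]eq_sym (negbTE ji) (negbTE ip) (negbTE iq).
Qed.

Hypothesis cardW : #|W| = n.

(** Two disjoint subsets of [W], each with at least half of the [n] elements, exhaust it. *)
Lemma dist2_cover w w' u : w \in W -> w' \in dist2 w -> u \in W ->
  (u \in dist2 w) || (u \in dist2 w').
Proof.
move=> wW w'A uW; have /dist2P [w'W _] := w'A.
rewrite -in_setU; suff -> : dist2 w :|: dist2 w' = W by [].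
apply/eqP; rewrite eqEcard; apply/andP; split.
  by apply/subsetP => v; rewrite in_setU => /orP [] /dist2P [].
rewrite cardsU; have := dist2_disjoint wW w'A; rewrite -setI_eq0 => /eqP ->.
rewrite cards0 subn0 cardW; have := card_dist2 wW; have := card_dist2 w'W; lia.
Qed.

End Paired.

(** * Identification of paired sets of size [n] *)

(** Vertices at distance 2 have exactly two common neighbours, each counted twice in [2 * n]. *)
Lemma card_symdiff_nbhd y z : #|symdiff y z| = 2 ->
  #|symdiff (nbhd (hypercube n) y) (nbhd (hypercube n) z)| + 4 = 2 * n.
Proof.
move=> /eqP /cards2P [a [b [ab Eab]]].
have Ez : z = flip a (flip b y).
  apply/setP => k; have /setP /(_ k) := Eab; rewrite in_symdiff !in_flip !inE.
  have [->|] := eqVneq k a; first by rewrite (negbTE ab); case: (_ \in y); case: (_ \in z).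
  by case: (k == b); case: (_ \in y); case: (_ \in z).
have EI : nbhd (hypercube n) y :&: nbhd (hypercube n) z = [set flip a y; flip b y].
  apply/setP => v; rewrite !nbhdE !inE; apply/andP/orP.
    case=> /imsetP [i _ ->] /imsetP [j _]; rewrite Ez => Ev.
    have [->|ia] := eqVneq i a; first by left.
    have [->|ib] := eqVneq i b; first by right.
    have ba : b != a by rewrite eq_sym.
    exfalso; have EE (x : 'I_n) : (x == i) = (x == a) (+) (x == b) (+) (x == j).
      have /setP /(_ x) := Ev; rewrite !in_flip.
      by case: (x \in y); case: (x == i); case: (x == j); case: (x == a); case: (x == b).
    have := EE a; rewrite eqxx (negbTE ab) eq_sym (negbTE ia) /= => /esym /negbFE /eqP aj.
    have := EE b; rewrite eqxx (negbTE ba) eq_sym (negbTE ib) /= => /esym /negbFE /eqP bj.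
    by move: ab; rewrite aj bj eqxx.
  case=> /eqP ->; split; try by apply: imset_f.
    by apply/imsetP; exists b => //; rewrite Ez flipC flipK.
  by apply/imsetP; exists a => //; rewrite Ez flipK.
have := card_symdiff (nbhd (hypercube n) y) (nbhd (hypercube n) z).
rewrite EI cards2 !card_nbhd (inj_eq (@flip_dir_inj y)) ab; lia.
Qed.

Lemma paired_min W : W != set0 -> paired W -> #|W| = n -> 0 < n ->
  (exists x, W = nbhd (hypercube n) x) \/
  (n = 4 /\ exists y z, #|symdiff y z| = 2 /\
     W = symdiff (nbhd (hypercube n) y) (nbhd (hypercube n) z)).
Proof.
move=> /set0Pn [w wW] pW cW n0; pose i := Ordinal n0.
have [j ji w'W] := partner_exists pW i wW.
have [/existsP [k /norP [ki kj]]|/existsPn only] := boolP [exists k, ~~ ((k == i) || (k == j))];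
  last first.
  (* With only the directions [i] and [j], the neighbours of [flip i w] are [w] and its partner
     vertex. *)
  left; exists (flip i w); apply/eqP; rewrite eq_sym eqEcard card_nbhd cW leqnn andbT.
  rewrite nbhdE; apply/subsetP => _ /imsetP [a _ ->].
  by have := only a; rewrite negbK => /orP [] /eqP -> //; rewrite flipK.
right; have [l lk uW] := partner_exists pW k wW.
set w' := flip j (flip i w) in w'W; set u := flip l (flip k w) in uW.
have neu : w' != u.
  apply/eqP => /setP /(_ k); rewrite !in_flip eqxx (negbTE ki) (negbTE kj).
  by rewrite [k == l]eq_sym (negbTE lk); case: (_ \in _).
have [ik il jk jl] := pairs_disjoint pW wW ji lk w'W uW neu.
have uA : u \in dist2 W w by apply/dist2P; split=> //; exists k, l.
(* At [w'] the directions [i] and [j] are partners of each other, since flipping both returns to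
   [w]. *)
have partner' m : m != i -> m != j ->
    exists m', [/\ m' != m, m' != i, m' != j & flip m' (flip m w') \in W].
  move=> mi mj; have [m' m'm vW] := partner_exists pW m w'W.
  exists m'; split=> //; apply: contraNneq m'm => E; subst m'.
    have vE : flip i (flip m w') = flip m (flip j w).
      by rewrite /w' flipC [flip j _]flipC flipK.
    rewrite vE in vW; have ij : i != j by rewrite eq_sym.
    rewrite /w' flipC in w'W.
    by rewrite (partner_unique pW wW mj ij vW w'W).
  have vE : flip j (flip m w') = flip m (flip i w) by rewrite /w' flipC flipK.
  by rewrite vE in vW; rewrite (partner_unique pW wW mi ji vW w'W).
have ijE : (i == j) = false by rewrite eq_sym; apply/negbTE.
(* A fifth direction [m] with its partner at [w'] gives a vertex of [W] differing from both [w] and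
   [u] in [i], [j] and [m], against [dist2_cover]. *)
have all4 m : [|| m == i, m == j, m == k | m == l].
  apply: contraT => /norP [mi /norP [mj /norP [mk ml]]].
  have [m' [m'm m'i m'j vW]] := partner' m mi mj.
  have [ij im jm] : [/\ i != j, i != m & j != m] by rewrite ijE ![_ == m]eq_sym.
  have := dist2_cover pW cW wW uA vW => /orP [] /dist2P [_ [a [b [ba Ev]]]]; exfalso;
  apply: (no_three_in_two (p := a) (q := b) ij im jm).
    split; [move/setP/(_ i): Ev|move/setP/(_ j): Ev|move/setP/(_ m): Ev];
      rewrite !in_flip eqxx ?ijE ?(negbTE ji) ?(negbTE mi) ?(negbTE mj)
        ?[i == m']eq_sym ?[j == m']eq_sym ?[m == m']eq_sym ?(negbTE m'm)
        ?(negbTE m'i) ?(negbTE m'j) ?[i == m]eq_sym ?[j == m]eq_sym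
        ?(negbTE mi) ?(negbTE mj); case: (_ \in w); case: (_ == a); by case: (_ == b).
  split; [move/setP/(_ i): Ev|move/setP/(_ j): Ev|move/setP/(_ m): Ev];
    rewrite !in_flip eqxx ?ijE ?(negbTE ji) ?(negbTE mi) ?(negbTE mj)
        ?[i == m']eq_sym ?[j == m']eq_sym ?[m == m']eq_sym ?(negbTE m'm)
        ?(negbTE m'i) ?(negbTE m'j) ?[i == m]eq_sym ?[j == m]eq_sym
        ?(negbTE mi) ?(negbTE mj) ?(negbTE ik) ?(negbTE il) ?(negbTE jk) ?(negbTE jl)
        ?(negbTE mk) ?(negbTE ml); case: (_ \in w); case: (_ == a); by case: (_ == b).
have n4 : n = 4.
  rewrite -[LHS]card_ord -cardsT.
  have -> : [set: 'I_n] = i |: (j |: [set k; l]).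
    by apply/setP => m; rewrite !inE; rewrite all4.
  by rewrite !cardsU1 cards1 !inE ijE (negbTE ik) (negbTE il) (negbTE jk) (negbTE jl)
    [k == l]eq_sym (negbTE lk).
(* The common neighbours of these centres are [w] with [i, k] or [i, l] flipped; the other
   neighbours are [w], [w'], [u] and [flip l (flip k w')]. *)
split=> //; exists (flip i w), (flip i u).
have c2 : #|symdiff (flip i w) (flip i u)| = 2.
  have -> : symdiff (flip i w) (flip i u) = [set k; l].
    apply/setP => m; rewrite in_symdiff !in_flip !inE.
    have [->|] := eqVneq m k; first by rewrite [k == l]eq_sym (negbTE lk); case: (_ \in w); case: (_ == i).
    by case: (_ \in w); case: (_ == i); case: (_ == l).
  by rewrite cards2 eq_sym lk.
split=> //; have cS := card_symdiff_nbhd c2.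
have vW : flip l (flip k w') \in W.
  have [m' [m'k m'i m'j]] := partner' k ki kj; have := all4 m'.
  by rewrite (negbTE m'k) (negbTE m'i) (negbTE m'j) => /eqP ->.
apply/eqP; rewrite eq_sym eqEcard cW; apply/andP; split; last by rewrite -(leq_add2r 4) cS n4.
have memN (x : {set 'I_n}) a : flip a x \in nbhd (hypercube n) x.
  by rewrite nbhdE; apply: imset_f.
apply/subsetP => v; rewrite in_symdiff.
have [|nvy] /= := boolP (v \in nbhd (hypercube n) (flip i w)).
  rewrite nbhdE => /imsetP [a _ ->]; have := all4 a.
  case/or4P => /eqP ->; rewrite ?flipK //.
    have -> : flip k (flip i w) = flip l (flip i u).
      by rewrite /u [flip i (flip l _)]flipC flipK flipC.
    by rewrite memN.
  have -> : flip l (flip i w) = flip k (flip i u).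
    by rewrite /u [flip l (flip k _)]flipC [flip i (flip k _)]flipC flipK flipC.
  by rewrite memN.
move: nvy => /[swap]; rewrite nbhdE => /imsetP [a _ ->]; have := all4 a.
case/or4P => /eqP ->; rewrite ?flipK //.
- move=> _; suff -> : flip j (flip i u) = flip l (flip k w') by [].
  by rewrite /u /w' [flip i (flip l _)]flipC [flip i (flip k _)]flipC
    [flip j (flip l _)]flipC [flip j (flip k _)]flipC.
- have -> : flip k (flip i u) = flip l (flip i w).
    by rewrite /u [flip l (flip k _)]flipC [flip i (flip k _)]flipC flipK flipC.
  by rewrite memN.
- have -> : flip l (flip i u) = flip k (flip i w).
    by rewrite /u [flip i (flip l _)]flipC flipK flipC.
  by rewrite memN.
Qed.

(** * Minimum zero blocking sets *)

(** A fort inside [W] with fewer than [n] vertices would be tight, hence have exactly [n]. *)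
Lemma zero_blocking_card W : zero_blocking (hypercube n) W -> n <= #|W|.
Proof.
move=> /zero_blocking_sub_fort [U [sub U0 d0]].
apply: leq_trans (subset_leq_card sub); rewrite leqNgt; apply/negP => lt.
have [|_] := card_add_defect_tight (D := setT) U0.
  by rewrite d0 cards0 addn0 cardsT card_ord ltnW.
by rewrite cardsT card_ord => E; rewrite E ltnn in lt.
Qed.

End Hypercube.

Theorem theorem6 (n : nat) (hn : 2 <= n) :
  zero_blocking_number (hypercube n) = n /\
  (forall W : {set {set 'I_n}}, zero_blocking (hypercube n) W ->
     (#|W| = n <->
      (exists x : {set 'I_n}, W = nbhd (hypercube n) x) \/
      (n = 4 /\
       exists y z : {set 'I_n},
         #|symdiff y z| = 2 /\
         W = symdiff (nbhd (hypercube n) y) (nbhd (hypercube n) z)))).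
Proof.
have n0 : 0 < n by exact: ltnW.
split.
  have [[W zbW cW] minB] := zero_blocking_number_min (hypercube n) set0.
  apply/eqP; rewrite eqn_leq -{2}cW (zero_blocking_card zbW) andbT.
  apply: leq_trans (minB (nbhd (hypercube n) set0) _) _; last by rewrite card_nbhd.
  apply: fort_zero_blocking (nbhd_fort _ hn).
  by rewrite -card_gt0 card_nbhd.
move=> W zbW; split=> [cW|].
  have [U [sub U0 d0]] := zero_blocking_sub_fort zbW.
  (* The fort [U] is itself zero blocking, so it has at least [n] vertices and fills [W]. *)
  have UW : U = W.
    apply/eqP; rewrite eqEcard sub cW; apply: zero_blocking_card.
    exact: fort_zero_blocking.
  move: U0 d0; rewrite {U sub}UW => W0 d0.
  have [N|P] := min_fort_nbhd_or_paired W0 d0 cW; first by left.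
  exact: paired_min.
case=> [[x ->]|[n4 [y [z [c2 ->]]]]]; first exact: card_nbhd.
by apply/eqP; rewrite -(eqn_add2r 4) (card_symdiff_nbhd c2) n4.
Qed.
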